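(* Let $x$ and $p$ be time-independent self-adjoint operators in an abstract complex Hilbert space obeying the canonical commutation rule $[x,p]=i$. Let $a,b,c,d,f,g$ be (suitable) real-valued functions of time $t$ only, and consider the nonautonomous quadratic Hamiltonian $$H=a(t)p^{2}+b(t)x^{2}+c(t)xp-i\,d(t)-f(t)x-g(t)p .$$ Let the real-valued functions $\alpha,\beta,\gamma,\delta,\varepsilon,\kappa$ of $t$ (with $\beta(t)\neq 0$) be a solution of the Ermakov-type system $$\frac{d\alpha}{dt}+b+2c\alpha+4a\alpha^{2}=a\beta^{4},\qquad \frac{d\beta}{dt}+(c+4a\alpha)\beta=0,\qquad \frac{d\gamma}{dt}+a\beta^{2}=0,$$ $$\frac{d\delta}{dt}+(c+4a\alpha)\delta-f-2g\alpha=2a\beta^{3}\varepsilon,\qquad \frac{d\varepsilon}{dt}-(g-2a\delta)\beta=0,\qquad \frac{d\kappa}{dt}-g\delta+a\delta^{2}=a\beta^{2}\varepsilon^{2}.$$ Define the time-dependent annihilation and creation operators $$\widehat b(t)=\frac{e^{-2i\gamma(t)}}{\sqrt2}\left(\beta(t)x+\varepsilon(t)+i\,\frac{p-2\alpha(t)x-\delta(t)}{\beta(t)}\right),$$ $$\widehat b^{\dagger}(t)=\frac{e^{2i\gamma(t)}}{\sqrt2}\left(\beta(t)x+\varepsilon(t)-i\,\frac{p-2\alpha(t)x-\delta(t)}{\beta(t)}\right).$$ Then the operators $$p_\lambda(t)=\frac{\widehat b(t)-\widehat b^{\dagger}(t)}{i\sqrt2},\qquad q_\lambda(t)=\frac{\widehat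 b(t)+\widehat b^{\dagger}(t)}{\sqrt2}$$ solve the Heisenberg equations of motion $$\frac{d}{dt}p_\lambda(t)=i\,[p_\lambda(t),H],\qquad \frac{d}{dt}q_\lambda(t)=i\,[q_\lambda(t),H],$$ and the commutation relation $$\widehat b(t)\widehat b^{\dagger}(t)-\widehat b^{\dagger}(t)\widehat b(t)=1$$ holds at all times.
   Context: Units are $\hbar=1$, and $[A,B]=AB-BA$. The subscript $\lambda$ in $p_\lambda,q_\lambda$ is only a mode label (a single mode is considered). The sign convention for the Heisenberg equations is $\frac{d}{dt}A=i[A,H]$ (the more usual convention is obtained by time reversal $t\to-t$). Operator identities are algebraic identities for polynomials in $x,p$ subject to $[x,p]=i$ (equivalently, they hold on a common invariant dense domain); scalars such as $\varepsilon(t)$ stand for multiples of the identity, and $d/dt$ acts on the time-dependent scalar coefficients. ''Suitable'' means regular enough (e.g. continuous) for the differential system to make sense. *)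

(* Defs.v *)
From HB Require Import structures.
From mathcomp Require Import all_boot all_order all_algebra.
From mathcomp Require Import sesquilinear.
From mathcomp Require Import all_classical all_reals all_analysis.
From mathcomp Require Export complex.
Import Order.TTheory GRing.Theory Num.Theory.
Import numFieldNormedType.Exports.

Set Implicit Arguments.
Unset Strict Implicit.
Unset Printing Implicit Defensive.

Local Open Scope classical_set_scope.
Local Open Scope ring_scope.

(* A complex Hilbert space is a complete normed R[i]-module whose norm comes
   from a positive definite Hermitian form, linear in its first argument. *)
Definition hilbert_norm (R : realType) (V : completeNormedModType R[i])
    (ip : {dot V for @Num.conj R[i]}) : Prop :=
  forall v : V, `|v| ^+ 2 = ip v v.

(* Possibly unbounded, partially defined operators.  The values of [op_app]
   outside [op_dom] are irrelevant. *)
Record op (T : Type) := Op { op_dom : set T ; op_app : T -> T }.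

Declare Scope op_scope.
Delimit Scope op_scope with op.
Bind Scope op_scope with op.

Section OpAlgebra.
Variables (K : numFieldType) (V : normedModType K).
Implicit Types (A B : op V) (D : set V).

Definition op_id : op V := Op setT id.
Definition op_scale (k : K) A : op V :=
  Op (op_dom A) (fun v => k *: op_app A v).
Definition op_add A B : op V :=
  Op (op_dom A `&` op_dom B) (fun v => op_app A v + op_app B v).
Definition op_sub A B : op V :=
  Op (op_dom A `&` op_dom B) (fun v => op_app A v - op_app B v).
Definition op_mul A B : op V :=
  Op (op_dom B `&` (op_app B @^-1` op_dom A)) (fun v => op_app A (op_app B v)).
Definition op_comm A B : op V := op_sub (op_mul A B) (op_mul B A).

Definition op_eq_on D A B : Prop :=
  [/\ D `<=` op_dom A, D `<=` op_dom B &
      forall v, D v -> op_app A v = op_app B v].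

Definition is_subspace D : Prop :=
  D 0 /\ forall (k : K) (u v : V), D u -> D v -> D (k *: u + v).

Definition linear_op A : Prop :=
  is_subspace (op_dom A) /\
  forall (k : K) (u v : V), op_dom A u -> op_dom A v ->
    op_app A (k *: u + v) = k *: op_app A u + op_app A v.

End OpAlgebra.

Arguments op_id {K V}.

Notation "1" := op_id : op_scope.
Notation "k *: A" := (op_scale k%R A) : op_scope.
Notation "A + B" := (op_add A B) : op_scope.
Notation "A - B" := (op_sub A B) : op_scope.
Notation "A * B" := (op_mul A B) : op_scope.
Notation "A = B 'on' D" := (op_eq_on D A%op B%op)
  (at level 70, B at next level, D at next level,
   format "A  =  B  'on'  D") : op_scope.
Notation "[op A , B ]" := (op_comm A B)
  (at level 0, A, B at level 99, format "[op  A ,  B ]") : op_scope.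

(* A = A^* : the two graphs coincide, where (u, w) is in the graph of A^*
   iff <A v, u> = <v, w> for all v in the domain of A. *)
Definition self_adjoint (R : realType) (V : completeNormedModType R[i])
    (ip : {dot V for @Num.conj R[i]}) (A : op V) : Prop :=
  [/\ linear_op A, dense (op_dom A) &
      forall u w : V,
        (op_dom A u /\ op_app A u = w) <->
        (forall v, op_dom A v -> ip (op_app A v) u = ip v w)].

(* The canonical commutation rule [x, p] = i, on a common invariant dense
   domain D. *)
Definition ccr (R : realType) (V : normedModType R[i])
    (D : set V) (x p : op V) : Prop :=
  [/\ is_subspace D, dense D,
      D `<=` op_dom x `&` (op_app x @^-1` D),
      D `<=` op_dom p `&` (op_app p @^-1` D) &
      ([op x, p] = 'i%C *: 1 on D)%op].

(* dA/dt = B at time t, as a strong derivative on D.  The difference quotient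
   is spelled out because time is real while V is a module over R[i]. *)
Definition op_derive (R : realType) (V : normedModType R[i])
    (D : set V) (A : R -> op V) (t : R) (B : op V) : Prop :=
  [/\ forall s, D `<=` op_dom (A s), D `<=` op_dom B &
      forall v, D v ->
        (h^-1)%:C%C *: (op_app (A (t + h)) v - op_app (A t) v) @[h --> 0^']
          --> op_app B v].

(* The sign is the time reversal of the usual convention. *)
Definition heisenberg (R : realType) (V : normedModType R[i])
    (D : set V) (A H : R -> op V) (t : R) : Prop :=
  op_derive D A t ('i%C *: [op A t, H t])%op.

Definition expi (R : realType) (theta : R) : R[i] :=
  (cos theta +i* sin theta)%C.

Section System.
Variable R : realType.
Implicit Types (a b c d f g alpha beta gamma delta epsilon kappa : R -> R).

Definition hamiltonian (V : normedModType R[i]) (x p : op V)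
    a b c d f g (t : R) : op V :=
  ((a t)%:C%C *: (p * p) + (b t)%:C%C *: (x * x) + (c t)%:C%C *: (x * p)
   - ('i%C * (d t)%:C%C) *: 1 - (f t)%:C%C *: x - (g t)%:C%C *: p)%op.

Definition ermakov_system a b c f g
    alpha beta gamma delta epsilon kappa (t : R) : Prop :=
  [/\ derivable alpha t 1, derivable beta t 1 & derivable gamma t 1] /\
  [/\ derivable delta t 1, derivable epsilon t 1 & derivable kappa t 1] /\
  [/\ derive1 alpha t + b t + 2 * c t * alpha t + 4 * a t * alpha t ^+ 2
        = a t * beta t ^+ 4,
      derive1 beta t + (c t + 4 * a t * alpha t) * beta t = 0 &
      derive1 gamma t + a t * beta t ^+ 2 = 0] /\
  [/\ derive1 delta t + (c t + 4 * a t * alpha t) * delta t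
          - f t - 2 * g t * alpha t
        = 2 * a t * beta t ^+ 3 * epsilon t,
      derive1 epsilon t - (g t - 2 * a t * delta t) * beta t = 0 &
      derive1 kappa t - g t * delta t + a t * delta t ^+ 2
        = a t * beta t ^+ 2 * epsilon t ^+ 2].

Section Ladder.
Variables (V : normedModType R[i]) (x p : op V).
Variables alpha beta gamma delta epsilon : R -> R.

Definition position_part (t : R) : op V :=
  ((beta t)%:C%C *: x + (epsilon t)%:C%C *: 1)%op.

Definition momentum_part (t : R) : op V :=
  ((beta t)^-1%:C%C *: (p - (2 * alpha t)%:C%C *: x - (delta t)%:C%C *: 1))%op.

Definition annihilation (t : R) : op V :=
  ((expi (- (2 * gamma t)) / (Num.sqrt 2)%:C%C) *:
     (position_part t + 'i%C *: momentum_part t))%op.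

Definition creation (t : R) : op V :=
  ((expi (2 * gamma t) / (Num.sqrt 2)%:C%C) *:
     (position_part t - 'i%C *: momentum_part t))%op.

Definition p_mode (t : R) : op V :=
  (('i%C * (Num.sqrt 2)%:C%C)^-1 *: (annihilation t - creation t))%op.

Definition q_mode (t : R) : op V :=
  (((Num.sqrt 2)%:C%C)^-1 *: (annihilation t + creation t))%op.

End Ladder.
End System.

(* Main.v *)
(* At each time every operator in the statement except [H] is affine in [x] and
   [p], and [[A, H]] is again affine for affine [A], since [[A, x]] and [[A, p]]
   are scalars.  With [Q = beta x + epsilon], [P = (p - 2 alpha x - delta) / beta]
   and [theta = 2 gamma], the modes are the rotated pair
   [q = cos theta Q + sin theta P], [p = - sin theta Q + cos theta P].  Both are
   of the form [u Q + w P] with [u' = 2 a beta^2 w] and [w' = - 2 a beta^2 u], so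
   a single comparison of the coefficients of [x], [p] and [1] proves both
   Heisenberg equations. *)
Require Import Defs.
From mathcomp Require Import all_boot all_order all_algebra.
From mathcomp Require Import sesquilinear.
From mathcomp Require Import all_classical all_reals all_analysis.
From mathcomp Require Import ring.
Import Order.TTheory GRing.Theory Num.Theory.
Import numFieldNormedType.Exports.

Local Open Scope classical_set_scope.
Local Open Scope ring_scope.

(** * Operators that leave a subspace [D] invariant, and their commutators on [D] *)

Section StableOperators.
Set Implicit Arguments.
Unset Strict Implicit.

Context {K : numFieldType} {V : normedModType K}.
Variable D : set V.
Hypothesis subD : is_subspace D.
Implicit Types (A B C E F : op V) (k : K) (u v : V).

(** Invariance makes every product of such operators defined on [D], so the domain conditions of
    partial operators are settled once. Linearity is asked for on [D] alone. *)
Definition stable_op A : Prop :=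
  [/\ D `<=` op_dom A, forall v, D v -> D (op_app A v) &
      forall k u v, D u -> D v ->
        op_app A (k *: u + v) = k *: op_app A u + op_app A v].

Lemma subspaceZ k v : D v -> D (k *: v).
Proof. by move=> Dv; rewrite -[_ *: _]addr0; apply: subD.2 => //; exact: subD.1. Qed.

Lemma subspaceD u v : D u -> D v -> D (u + v).
Proof. by move=> Du Dv; rewrite -[u]scale1r; exact: subD.2. Qed.

Lemma stable_add A u v : stable_op A -> D u -> D v ->
  op_app A (u + v) = op_app A u + op_app A v.
Proof. by case=> _ _ linA Du Dv; rewrite -{1}[u]scale1r linA// scale1r. Qed.

Lemma stable_zero A : stable_op A -> op_app A 0 = 0.
Proof.
move=> sA; have /esym/eqP := stable_add sA subD.1 subD.1.
by rewrite addr0 -[X in _ == X]addr0 (inj_eq (addrI _)) => /eqP.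
Qed.

Lemma stable_scale A k v : stable_op A -> D v ->
  op_app A (k *: v) = k *: op_app A v.
Proof.
move=> sA Dv; rewrite -[k *: v]addr0; case: (sA) => _ _ -> //; last exact: subD.1.
by rewrite (stable_zero sA) addr0.
Qed.

Lemma stable_sub A u v : stable_op A -> D u -> D v ->
  op_app A (u - v) = op_app A u - op_app A v.
Proof.
move=> sA Du Dv; rewrite -(scaleN1r v) -(scaleN1r (op_app A v))
  stable_add// ?stable_scale//.
exact: subspaceZ.
Qed.

Lemma op_eq_on_refl A : D `<=` op_dom A -> (A = A on D)%op.
Proof. by []. Qed.

Lemma op_eq_on_trans {A B C} : (A = B on D)%op -> (B = C on D)%op -> (A = C on D)%op.
Proof.
move=> [dA _ AB] [_ dC BC]; split=> // v Dv; by rewrite AB// BC.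
Qed.

Lemma stable_op_eq_on {A B} : (A = B on D)%op -> stable_op B -> stable_op A.
Proof.
case=> dA _ AB [_ B_D B_lin]; split=> // [v Dv|k u v Du Dv].
- by rewrite AB//; exact: B_D.
- by rewrite !AB//; [exact: B_lin|exact: subD.2].
Qed.

Lemma stable_op_id : stable_op op_id.
Proof. by split. Qed.

Lemma stable_op_scale k A : stable_op A -> stable_op (k *: A)%op.
Proof.
case=> dA A_D A_lin; split=> //= [v Dv|k' u v Du Dv].
- by apply: subspaceZ; exact: A_D.
- by rewrite A_lin// scalerDr !scalerA mulrC.
Qed.

Lemma stable_op_add A B : stable_op A -> stable_op B -> stable_op (A + B)%op.
Proof.
move=> [dA A_D A_lin] [dB B_D B_lin]; split=> /= [v Dv|v Dv|k u v Du Dv].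
- by split; [exact: dA|exact: dB].
- by apply: subspaceD; [exact: A_D|exact: B_D].
- by rewrite A_lin// B_lin// scalerDr addrACA.
Qed.

Lemma stable_op_sub A B : stable_op A -> stable_op B -> stable_op (A - B)%op.
Proof.
move=> sA sB; apply: (@stable_op_eq_on _ (A + (-1) *: B)%op).
  case: sA sB => dA _ _ [dB _ _]; split=> /= [v Dv|v Dv|v Dv].
  - by split; [exact: dA|exact: dB].
  - by split; [exact: dA|exact: dB].
  - by rewrite scaleN1r.
by apply: stable_op_add => //; exact: stable_op_scale.
Qed.

Lemma stable_op_mul A B : stable_op A -> stable_op B -> stable_op (A * B)%op.
Proof.
move=> [dA A_D A_lin] [dB B_D B_lin]; split=> /= [v Dv|v Dv|k u v Du Dv].
- by split; [exact: dB|apply: dA; exact: B_D].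
- by apply: A_D; exact: B_D.
- by rewrite B_lin// A_lin//; exact: B_D.
Qed.

Lemma op_comm_onP A B E : stable_op A -> stable_op B -> D `<=` op_dom E ->
  (forall v, D v ->
    op_app A (op_app B v) - op_app B (op_app A v) = op_app E v) ->
  ([op A, B] = E on D)%op.
Proof.
move=> sA sB dE AB; split=> // v Dv.
by split; [case: (stable_op_mul sA sB)|case: (stable_op_mul sB sA)] => + _ _; exact.
Qed.

(** Agreement on [D] suffices to replace both entries of a commutator, because the factor acting
    first sends [D] into [D], where the other factor may be replaced too. *)
Lemma op_comm_eq_on {A A' B B'} : stable_op A' -> stable_op B' ->
  (A = A' on D)%op -> (B = B' on D)%op -> ([op A, B] = [op A', B'] on D)%op.
Proof.
move=> sA' sB' AA' BB'.
have sA := stable_op_eq_on AA' sA'; have sB := stable_op_eq_on BB' sB'.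
case: (AA') (BB') => _ _ eA [_ _ eB].
case: (sA') (sB') => dA' A'_D _ [dB' B'_D _].
apply: op_comm_onP => //= [v Dv|v Dv].
  do 2!split => //=; [exact: dB'|apply: dA'; exact: B'_D|exact: dA'|
    apply: dB'; exact: A'_D].
by rewrite (eB v)// (eA v)// eA ?eB//; [exact: A'_D|exact: B'_D].
Qed.

(** For fixed [A], the map from [B] to [[A, B]] is a derivation. Carrying the stability of [B] along
    with its bracket lets the rules below be chained over the shape of an operator. *)
Definition stable_comm A B C : Prop :=
  stable_op B /\ ([op A, B] = C on D)%op.

Lemma stable_comm_trans A B C E :
  stable_comm A B C -> (C = E on D)%op -> stable_comm A B E.
Proof. by move=> [sB AB] CE; split=> //; exact: op_eq_on_trans AB CE. Qed.

Section StableCommutator.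
Variable A : op V.
Hypothesis sA : stable_op A.

Lemma stable_comm_app B C v : stable_comm A B C -> D v ->
  op_app C v = op_app A (op_app B v) - op_app B (op_app A v).
Proof. by case=> _ [_ _ AB] Dv; rewrite -AB. Qed.

Lemma stable_comm_scale k B C : stable_comm A B C -> stable_comm A (k *: B) (k *: C).
Proof.
move=> AB; have [sB [_ dC _]] := AB; split; first exact: stable_op_scale.
apply: op_comm_onP => //=; first exact: stable_op_scale.
move=> v Dv; rewrite (stable_comm_app AB Dv) scalerBr (stable_scale _ sA)//.
by case: sB => _ + _; exact.
Qed.

Lemma stable_comm_add B C E F :
  stable_comm A B E -> stable_comm A C F -> stable_comm A (B + C) (E + F).
Proof.
move=> AB AC; have [sB [_ dE _]] := AB; have [sC [_ dF _]] := AC.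
split; first exact: stable_op_add.
apply: op_comm_onP => //=; first exact: stable_op_add.
  by move=> v Dv; split; [exact: dE|exact: dF].
move=> v Dv; rewrite (stable_comm_app AB Dv) (stable_comm_app AC Dv).
case: sB sC => _ B_D _ [_ C_D _].
by rewrite (stable_add sA (B_D _ Dv) (C_D _ Dv)) opprD addrACA.
Qed.

Lemma stable_comm_sub B C E F :
  stable_comm A B E -> stable_comm A C F -> stable_comm A (B - C) (E - F).
Proof.
move=> AB AC; have [sB [_ dE _]] := AB; have [sC [_ dF _]] := AC.
split; first exact: stable_op_sub.
apply: op_comm_onP => //=; first exact: stable_op_sub.
  by move=> v Dv; split; [exact: dE|exact: dF].
move=> v Dv; rewrite (stable_comm_app AB Dv) (stable_comm_app AC Dv).
case: sB sC => _ B_D _ [_ C_D _].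
rewrite (stable_sub sA (B_D _ Dv) (C_D _ Dv)) !opprB addrACA [RHS]addrACA.
by congr (_ + _); exact: addrC.
Qed.

(** Leibniz rule [[A, BC] = [A, B] C + B [A, C]] for scalar brackets, where [B l] becomes [l B] by
    linearity. *)
Lemma stable_comm_mul B C k l :
  stable_comm A B (k *: 1) -> stable_comm A C (l *: 1) ->
  stable_comm A (B * C) (k *: C + l *: B).
Proof.
move=> AB AC; have [sB _] := AB; have [sC _] := AC.
case: (sA) (sB) (sC) => dA A_D _ [dB B_D _] [dC C_D _].
split; first exact: stable_op_mul.
apply: op_comm_onP => //=; first exact: stable_op_mul.
  by move=> v Dv; split; [exact: dC|exact: dB].
(* The bracket with [B] is evaluated at [C v], and the one with [C] inside [B]; the two middle terms
   [B (A (C v))] then cancel. *)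
move=> v Dv; have /= -> := stable_comm_app AB (C_D _ Dv).
rewrite -(stable_scale l sB)//; have /= -> := stable_comm_app AC Dv.
rewrite stable_sub//.
- by rewrite addrA subrK.
- exact/A_D/C_D.
- exact/C_D/A_D.
Qed.

End StableCommutator.

End StableOperators.

(** * Affine combinations of [x], [p] and [1], and their commutators *)

Section AffineOperators.
Set Implicit Arguments.
Unset Strict Implicit.

Context {R : realType} {V : normedModType R[i]}.
Variables (D : set V) (x p : op V).
Hypotheses (sx : stable_op D x) (sp : stable_op D p).
Hypotheses (xp_ccr : ccr D x p).
Implicit Types (A B H : op V) (k l : R[i]).

Let subD : is_subspace D. Proof. by case: xp_ccr. Qed.

Definition affine k1 k2 k3 : op V := (k1 *: x + k2 *: p + k3 *: 1)%op.

Arguments affine (k1 k2 k3)%_R.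

Lemma stable_affine k1 k2 k3 : stable_op D (affine k1 k2 k3).
Proof.
by do 2?apply: stable_op_add => //; apply: stable_op_scale => //; exact: stable_op_id.
Qed.

Lemma affine_dom k1 k2 k3 : D `<=` op_dom (affine k1 k2 k3).
Proof. by case: (stable_affine k1 k2 k3). Qed.

Lemma affine_x : (x = affine 1 0 0 on D)%op.
Proof.
case: sx => dx _ _; split=> //; first exact: affine_dom.
by move=> v Dv /=; rewrite scale1r !scale0r !addr0.
Qed.

Lemma affine_p : (p = affine 0 1 0 on D)%op.
Proof.
case: sp => dp _ _; split=> //; first exact: affine_dom.
by move=> v Dv /=; rewrite scale1r !scale0r addr0 add0r.
Qed.

Lemma affine_id : (1 = affine 0 0 1 on D)%op.
Proof.
split=> //; first exact: affine_dom.
by move=> v Dv /=; rewrite scale1r !scale0r !add0r.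
Qed.

Lemma affine_scale k A k1 k2 k3 : (A = affine k1 k2 k3 on D)%op ->
  (k *: A = affine (k * k1) (k * k2) (k * k3) on D)%op.
Proof.
case=> dA _ eA; split=> //=; first exact: affine_dom.
by move=> v Dv; rewrite eA//= !scalerDr !scalerA.
Qed.

Lemma affine_add A B k1 k2 k3 l1 l2 l3 :
  (A = affine k1 k2 k3 on D)%op -> (B = affine l1 l2 l3 on D)%op ->
  (A + B = affine (k1 + l1) (k2 + l2) (k3 + l3) on D)%op.
Proof.
case=> dA _ eA [dB _ eB]; split=> /= [v Dv||v Dv].
- by split; [exact: dA|exact: dB].
- exact: affine_dom.
- by rewrite eA// eB//= !scalerDl (addrACA (_ + _)) (addrACA (k1 *: _)).
Qed.

Lemma affine_sub A B k1 k2 k3 l1 l2 l3 :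
  (A = affine k1 k2 k3 on D)%op -> (B = affine l1 l2 l3 on D)%op ->
  (A - B = affine (k1 - l1) (k2 - l2) (k3 - l3) on D)%op.
Proof.
case=> dA _ eA [dB _ eB]; split=> /= [v Dv||v Dv].
- by split; [exact: dA|exact: dB].
- exact: affine_dom.
- by rewrite eA// eB//= !scalerBl !opprD (addrACA (_ + _)) (addrACA (k1 *: _)).
Qed.

Lemma ccr_app v : D v ->
  op_app x (op_app p v) - op_app p (op_app x v) = 'i%C *: v.
Proof. by case: xp_ccr => _ _ _ _ [_ _ +] Dv => /(_ v Dv). Qed.

(** Only the [p] term fails to commute with [x]; it contributes [k2 [p, x]]. *)
Lemma stable_comm_affine_x k1 k2 k3 :
  stable_comm D (affine k1 k2 k3) x ((- (k2 * 'i%C)) *: 1).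
Proof.
case: (sx) (sp) => _ x_D _ [_ p_D _].
split=> //; apply: op_comm_onP => //=; first exact: stable_affine.
move=> v Dv; have Dxv := x_D v Dv; have Dpv := p_D v Dv.
rewrite !(stable_add sx)//; do ?[exact: subspaceZ|apply: subspaceD => //].
rewrite !(stable_scale subD _ sx)// opprD addrACA subrr addr0.
by rewrite opprD addrACA subrr add0r -scalerBr -opprB ccr_app// scalerN scalerA scaleNr.
Qed.

Lemma stable_comm_affine_p k1 k2 k3 :
  stable_comm D (affine k1 k2 k3) p ((k1 * 'i%C) *: 1).
Proof.
case: (sx) (sp) => _ x_D _ [_ p_D _].
split=> //; apply: op_comm_onP => //=; first exact: stable_affine.
move=> v Dv; have Dxv := x_D v Dv; have Dpv := p_D v Dv.
rewrite !(stable_add sp)//; do ?[exact: subspaceZ|apply: subspaceD => //].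
rewrite !(stable_scale subD _ sp)// opprD addrACA subrr addr0.
by rewrite opprD addrACA subrr addr0 -scalerBr ccr_app// scalerA.
Qed.

Lemma stable_comm_affine_id k1 k2 k3 :
  stable_comm D (affine k1 k2 k3) 1 (0 *: 1).
Proof.
split; first exact: stable_op_id.
apply: op_comm_onP => //=; first exact: stable_affine.
by move=> v Dv; rewrite subrr scale0r.
Qed.

(** The bracket is bilinear with [[x, p] = i], so it is [i] times the determinant of the
    coefficients of [x] and [p]. *)
Lemma op_comm_affine k1 k2 k3 l1 l2 l3 :
  ([op affine k1 k2 k3, affine l1 l2 l3] =
   ('i%C * (k1 * l2 - k2 * l1))%R *: 1 on D)%op.
Proof.
have sA := stable_affine k1 k2 k3.
have Ax := stable_comm_affine_x k1 k2 k3.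
have Ap := stable_comm_affine_p k1 k2 k3.
have A1 := stable_comm_affine_id k1 k2 k3.
have scale := stable_comm_scale subD sA.
have add := stable_comm_add subD sA.
have [_ AB] := add _ _ _ _
  (add _ _ _ _ (scale l1 _ _ Ax) (scale l2 _ _ Ap)) (scale l3 _ _ A1).
apply: (op_eq_on_trans AB); split=> //= v Dv.
by rewrite !scalerA -!scalerDl; congr (_ *: _); ring.
Qed.

Lemma stable_comm_affine_hamiltonian (a b c d f g : R -> R) (t : R) k1 k2 k3 :
  stable_comm D (affine k1 k2 k3) (hamiltonian x p a b c d f g t)
   (affine ('i%C * ((c t)%:C%C * k1 - 2 * (b t)%:C%C * k2))
           ('i%C * (2 * (a t)%:C%C * k1 - (c t)%:C%C * k2))
           ('i%C * ((f t)%:C%C * k2 - (g t)%:C%C * k1))).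
Proof.
have sA := stable_affine k1 k2 k3.
have Ax := stable_comm_affine_x k1 k2 k3.
have Ap := stable_comm_affine_p k1 k2 k3.
have A1 := stable_comm_affine_id k1 k2 k3.
(* The bracket is left open and filled in by the derivation rules as they follow the shape of the
   Hamiltonian. *)
eapply stable_comm_trans.
  do 3!(eapply (stable_comm_sub subD sA);
    last by eapply (stable_comm_scale subD sA); eassumption).
  do 2?(eapply (stable_comm_add subD sA); last first);
    by eapply (stable_comm_scale subD sA); eapply (stable_comm_mul subD sA);
       eassumption.
(* The bracket so built is now normalised to affine form. Its summands mirror those of the
   Hamiltonian, each product giving two terms in Leibniz order. *)
have Zx := affine_scale _ affine_x; have Zp := affine_scale _ affine_p.
have Z1 := affine_scale _ affine_id.
have := affine_sub (affine_sub (affine_sub (affine_add (affine_add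
  (affine_scale (a t)%:C%C (affine_add (Zp (k1 * 'i%C)) (Zp (k1 * 'i%C))))
  (affine_scale (b t)%:C%C (affine_add (Zx (- (k2 * 'i%C))) (Zx (- (k2 * 'i%C))))))
  (affine_scale (c t)%:C%C (affine_add (Zp (- (k2 * 'i%C))) (Zx (k1 * 'i%C)))))
  (affine_scale ('i%C * (d t)%:C%C) (Z1 0)))
  (affine_scale (f t)%:C%C (Z1 (- (k2 * 'i%C)))))
  (affine_scale (g t)%:C%C (Z1 (k1 * 'i%C))).
by congr (_ = affine _ _ _ on _)%op; ring.
Qed.

End AffineOperators.

Arguments affine {R V} (x p)%_op (k1 k2 k3)%_R.

(** * Limits of real coefficients in [R[i]], and rotation identities *)

Section RealCoefficients.
Context {R : realType}.
Set Implicit Arguments.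
Unset Strict Implicit.

Lemma cvg_real_complex (T : Type) (F : set_system T) (FF : Filter F)
    (u : T -> R) (l : R) :
  u @ F --> l -> (u s)%:C%C @[s --> F] --> (l%:C%C : R[i]^o).
Proof.
move=> /cvgrPdist_lt ul; apply/(@cvgrPdist_lt R[i] R[i]^o) => e e0.
(* A positive element of [R[i]] has zero imaginary part, so the radius is real. *)
have [r r0 ->] : exists2 r : R, 0 < r & e = r%:C%C.
  exists (complex.Re e); last by rewrite RRe_real// gtr0_real.
  by rewrite -ltcR RRe_real// gtr0_real.
near=> s.
rewrite -rmorphB normc_def/= expr0n addr0 sqrtr_sqr ltcR.
by near: s; exact: ul.
Unshelve. all: by end_near. Qed.

Lemma is_derive_cvg (k : R -> R) (t dk : R) : is_derive t 1 k dk ->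
  h^-1 * (k (t + h) - k t) @[h --> 0^'] --> dk.
Proof.
case=> kt <-; suff -> : (fun h => h^-1 * (k (t + h) - k t)) =
  (fun h => h^-1 *: ((k \o shift t) (h *: 1) - k t)) by exact: kt.
by apply/funext => h /=; rewrite [h *: _]mulr1 [t + h]addrC.
Qed.

(** With [C], [S] the cosine and sine of an angle and [r] the root of 2, this recovers the real part
    of [(C - i S) (u + i w)] for real [u], [w]; [rotation_sin] recovers the imaginary part. *)
Lemma rotation_cos (C S u w r i : R[i]) : r != 0 -> r ^+ 2 = 2 -> i ^+ 2 = -1 ->
  r^-1 * ((C - i * S) / r * (u + i * w) + (C + i * S) / r * (u - i * w))
    = C * u + S * w.
Proof.
move=> r0 r2 i2.
(* In the middle term [i] and [r] occur only through their known squares. *)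
transitivity ((2 * C * u - 2 * i ^+ 2 * S * w) / r ^+ 2); first by field.
by rewrite i2 r2; field.
Qed.

Lemma rotation_sin (C S u w r i : R[i]) : r != 0 -> r ^+ 2 = 2 -> i ^+ 2 = -1 ->
  (i * r)^-1 * ((C - i * S) / r * (u + i * w) - (C + i * S) / r * (u - i * w))
    = - S * u + C * w.
Proof.
move=> r0 r2 i2; have i0 : i != 0.
  by apply: contra_eq_neq i2 => ->; rewrite expr0n /= eq_sym oppr_eq0 oner_eq0.
transitivity ((2 * C * w - 2 * S * u) / r ^+ 2); first by field; rewrite r0.
by rewrite r2; field.
Qed.

Lemma expiE (th : R) : expi th = (cos th)%:C%C + 'i%C * (sin th)%:C%C.
Proof. by apply/eqP; rewrite eq_complex /=; apply/andP; split; apply/eqP; ring. Qed.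

Lemma expiN (th : R) : expi (- th) = (cos th)%:C%C - 'i%C * (sin th)%:C%C.
Proof. by rewrite expiE cosN sinN rmorphN mulrN. Qed.

End RealCoefficients.

(** * Heisenberg equations for affine operators *)

Section Modes.
Context {R : realType} {V : normedModType R[i]}.
Set Implicit Arguments.
Unset Strict Implicit.
Variables (D : set V) (x p : op V).
Hypotheses (sx : stable_op D x) (sp : stable_op D p).
Hypotheses (xp_ccr : ccr D x p).

(** Since [x] and [p] do not depend on time, the strong derivative falls on the scalar
    coefficients. *)
Lemma op_derive_affine (A : R -> op V) (k1 k2 k3 : R -> R) (t l1 l2 l3 : R) (B : op V) :
  (forall s, A s = affine x p (k1 s)%:C%C (k2 s)%:C%C (k3 s)%:C%C on D)%op ->
  is_derive t 1 k1 l1 -> is_derive t 1 k2 l2 -> is_derive t 1 k3 l3 ->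
  (B = affine x p l1%:C%C l2%:C%C l3%:C%C on D)%op ->
  op_derive D A t B.
Proof.
move=> eA dk1 dk2 dk3 [dB _ eB]; split=> // [s|v Dv]; first by case: (eA s).
rewrite eB//=.
have cvgk k l (w : V) : is_derive t 1 k l ->
    (h^-1 * (k (t + h) - k t))%:C%C *: w @[h --> 0^'] --> (l%:C%C : R[i]^o) *: w.
  by move=> dk; apply: cvgZr_tmp; apply: cvg_real_complex; exact: is_derive_cvg.
apply: cvg_trans (cvgD (cvgD (cvgk _ _ (op_app x v) dk1)
  (cvgk _ _ (op_app p v) dk2)) (cvgk _ _ v dk3)).
apply: near_eq_cvg; apply: nearW => h /=.
have [_ _ ->]// := eA (t + h); have [_ _ ->]// := eA t.
rewrite !fctE /= !rmorphM !rmorphB/= -!scalerA -!scalerDr !scalerBl; congr (_ *: _).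
by rewrite !opprD [RHS]addrACA; congr (_ + _); exact: addrACA.
Qed.

(** The three derivatives are the coefficients of [i [A, H]]; the two factors [i] make the sign
    [-1]. *)
Lemma heisenberg_affine (a b c d f g k1 k2 k3 : R -> R) (A : R -> op V) (t : R) :
  (forall s, A s = affine x p (k1 s)%:C%C (k2 s)%:C%C (k3 s)%:C%C on D)%op ->
  is_derive t 1 k1 (2 * b t * k2 t - c t * k1 t) ->
  is_derive t 1 k2 (c t * k2 t - 2 * a t * k1 t) ->
  is_derive t 1 k3 (g t * k1 t - f t * k2 t) ->
  heisenberg D A (hamiltonian x p a b c d f g) t.
Proof.
move=> eA dk1 dk2 dk3; apply: (op_derive_affine eA dk1 dk2 dk3).
have subD : is_subspace D by case: xp_ccr.
have [sH AH] := stable_comm_affine_hamiltonian sx sp xp_ccr a b c d f g t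
  (k1 t)%:C%C (k2 t)%:C%C (k3 t)%:C%C.
have dH : D `<=` op_dom (hamiltonian x p a b c d f g t) by case: sH.
have := op_comm_eq_on subD (stable_affine sx sp xp_ccr _ _ _) sH
  (eA t) (op_eq_on_refl dH).
move=> /op_eq_on_trans/(_ AH)/(affine_scale sx sp xp_ccr 'i%C).
rewrite !mulrA -expr2 sqr_i.
by congr (_ = affine _ _ _ _ _ on _)%op;
  rewrite !(rmorphB, rmorphM) /= ?rmorph_nat; ring.
Qed.

(** * Ladder operators and modes in affine form *)

Section Ladder.
Variables alpha beta gamma delta epsilon : R -> R.

Lemma position_part_affine t :
  (position_part x beta epsilon t =
    affine x p (beta t)%:C%C 0 (epsilon t)%:C%C on D)%op.
Proof.
have := affine_add sx sp xp_ccr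
  (affine_scale sx sp xp_ccr (beta t)%:C%C (affine_x sx sp xp_ccr))
  (affine_scale sx sp xp_ccr (epsilon t)%:C%C (affine_id sx sp xp_ccr)).
by congr (_ = affine _ _ _ _ _ on _)%op; ring.
Qed.

Lemma momentum_part_affine t :
  (momentum_part x p alpha beta delta t =
    affine x p (- (2 * alpha t / beta t))%:C%C (beta t)^-1%:C%C
      (- (delta t / beta t))%:C%C on D)%op.
Proof.
have af_scale := affine_scale sx sp xp_ccr; have af_sub := affine_sub sx sp xp_ccr.
have := af_scale (beta t)^-1%:C%C _ _ _ _ (af_sub _ _ _ _ _ _ _ _
  (af_sub _ _ _ _ _ _ _ _ (affine_p sx sp xp_ccr)
    (af_scale (2 * alpha t)%:C%C _ _ _ _ (affine_x sx sp xp_ccr)))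
  (af_scale (delta t)%:C%C _ _ _ _ (affine_id sx sp xp_ccr))).
congr (_ = affine _ _ _ _ _ on _)%op; rewrite !(rmorphN, rmorphM) /=; ring.
Qed.

(** Coefficients of the position part [Q] and the momentum part [P] along [x], [p], [1]; that of [Q]
    along [p] is 0. *)
Let Q1 t := (beta t)%:C%C : R[i].
Let Q3 t := (epsilon t)%:C%C : R[i].
Let P1 t := (- (2 * alpha t / beta t))%:C%C : R[i].
Let P2 t := ((beta t)^-1)%:C%C : R[i].
Let P3 t := (- (delta t / beta t))%:C%C : R[i].

Lemma annihilation_affine t :
  let e := expi (- (2 * gamma t)) / (Num.sqrt 2)%:C%C in
  (annihilation x p alpha beta gamma delta epsilon t =
    affine x p (e * (Q1 t + 'i%C * P1 t)) (e * (0 + 'i%C * P2 t))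
      (e * (Q3 t + 'i%C * P3 t)) on D)%op.
Proof.
apply: (affine_scale sx sp xp_ccr); apply: (affine_add sx sp xp_ccr).
  exact: position_part_affine.
by apply: (affine_scale sx sp xp_ccr); exact: momentum_part_affine.
Qed.

Lemma creation_affine t :
  let e := expi (2 * gamma t) / (Num.sqrt 2)%:C%C in
  (creation x p alpha beta gamma delta epsilon t =
    affine x p (e * (Q1 t - 'i%C * P1 t)) (e * (0 - 'i%C * P2 t))
      (e * (Q3 t - 'i%C * P3 t)) on D)%op.
Proof.
apply: (affine_scale sx sp xp_ccr); apply: (affine_sub sx sp xp_ccr).
  exact: position_part_affine.
by apply: (affine_scale sx sp xp_ccr); exact: momentum_part_affine.
Qed.

Lemma sqrt2_neq0 : (Num.sqrt 2)%:C%C != 0 :> R[i].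
Proof. by rewrite fmorph_eq0 gt_eqF// sqrtr_gt0. Qed.

Lemma sqr_sqrt2 : (Num.sqrt 2)%:C%C ^+ 2 = 2 :> R[i].
Proof. by rewrite -rmorphXn /= sqr_sqrtr// rmorph_nat. Qed.

(* The coefficients of [x], [p] and [1] in [u Q + w P]. *)
Definition mode_x (u w : R -> R) t := u t * beta t - w t * (2 * alpha t / beta t).
Definition mode_p (w : R -> R) t := w t / beta t.
Definition mode_1 (u w : R -> R) t := u t * epsilon t - w t * (delta t / beta t).

Lemma q_mode_affine t :
  let u s := cos (2 * gamma s) in let w s := sin (2 * gamma s) in
  (q_mode x p alpha beta gamma delta epsilon t =
   affine x p (mode_x u w t)%:C%C (mode_p w t)%:C%C (mode_1 u w t)%:C%C on D)%op.
Proof.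
move=> u w.
have := affine_scale sx sp xp_ccr ((Num.sqrt 2)%:C%C)^-1
  (affine_add sx sp xp_ccr (annihilation_affine t) (creation_affine t)).
rewrite expiN expiE.
by congr (_ = affine _ _ _ _ _ on _)%op;
  rewrite (rotation_cos _ _ _ _ sqrt2_neq0 sqr_sqrt2 (sqr_i R))
    /Q1 /Q3 /P1 /P2 /P3 /mode_x /mode_p /mode_1
    !(rmorphB, rmorphN, rmorphM) /=; ring.
Qed.

Lemma p_mode_affine t :
  let u s := - sin (2 * gamma s) in let w s := cos (2 * gamma s) in
  (p_mode x p alpha beta gamma delta epsilon t =
   affine x p (mode_x u w t)%:C%C (mode_p w t)%:C%C (mode_1 u w t)%:C%C on D)%op.
Proof.
move=> u w.
have := affine_scale sx sp xp_ccr ('i%C * (Num.sqrt 2)%:C%C)^-1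
  (affine_sub sx sp xp_ccr (annihilation_affine t) (creation_affine t)).
rewrite expiN expiE.
by congr (_ = affine _ _ _ _ _ on _)%op;
  rewrite (rotation_sin _ _ _ _ sqrt2_neq0 sqr_sqrt2 (sqr_i R))
    /Q1 /Q3 /P1 /P2 /P3 /mode_x /mode_p /mode_1
    !(rmorphB, rmorphN, rmorphM) /=; ring.
Qed.

(** The phases are inverse to each other, and [[Q, P] = i] because [beta] and its inverse cancel
    while [alpha] only shears. *)
Lemma ladder_ccr t : beta t != 0 ->
  ([op annihilation x p alpha beta gamma delta epsilon t,
       creation x p alpha beta gamma delta epsilon t] = 1 on D)%op.
Proof.
move=> b0; have subD : is_subspace D by case: xp_ccr.
have stA := stable_affine sx sp xp_ccr.
have := op_comm_eq_on subD (stA _ _ _) (stA _ _ _)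
  (annihilation_affine t) (creation_affine t).
move=> /op_eq_on_trans/(_ (op_comm_affine sx sp xp_ccr _ _ _ _ _ _)).
move=> /op_eq_on_trans; apply; split=> // v Dv /=.
rewrite -[RHS]scale1r; congr (_ *: _).
have b0' : Q1 t != 0 by rewrite /Q1 fmorph_eq0.
have -> : P2 t = (Q1 t)^-1 by rewrite /P2 fmorphV.
set em := expi (- _); set ep := expi _.
have ee : em * ep = 1.
  rewrite /em /ep expiN expiE -subr_sqr exprMn sqr_i mulN1r opprK.
  by rewrite -!rmorphXn -rmorphD /= cos2Dsin2.
(* The determinant of the coefficients is [- 2 i Q1 P2] times the phases over 2. *)
transitivity (- 'i%C ^+ 2 * (em * ep) * 2 / (Num.sqrt 2)%:C%C ^+ 2).
  by field; rewrite b0' sqrt2_neq0.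
by rewrite ee sqr_sqrt2 sqr_i; field.
Qed.

(** The Ermakov equations amount to [Q' - i [Q, H] = 2 a beta^2 P] and [P' - i [P, H] = - 2 a beta^2
    Q]. The assumed derivatives of [u] and [w] cancel exactly this rotation. *)
Lemma heisenberg_mode (a b c d f g kappa u w : R -> R) (A : R -> op V) (t : R) :
  beta t != 0 ->
  ermakov_system a b c f g alpha beta gamma delta epsilon kappa t ->
  is_derive t 1 u (2 * a t * beta t ^+ 2 * w t) ->
  is_derive t 1 w (- (2 * a t * beta t ^+ 2 * u t)) ->
  (forall s, A s = affine x p (mode_x u w s)%:C%C (mode_p w s)%:C%C
    (mode_1 u w s)%:C%C on D)%op ->
  heisenberg D A (hamiltonian x p a b c d f g) t.
Proof.
move=> b0 [[da db dc] [[dd de _] [[ea eb ec] [ed ee _]]]] du dw eA.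
have {}da := derivableP da; have {}db := derivableP db.
have {}dd := derivableP dd; have {}de := derivableP de.
rewrite -derive1E in da; rewrite -derive1E in db.
rewrite -derive1E in dd; rewrite -derive1E in de.
have dbV : is_derive t 1 (fun s => (beta s)^-1) _ := is_deriveV b0 db.
(* Each equation is solved for its derivative, ready for substitution. *)
have ea' : alpha^`()%classic t =
    a t * beta t ^+ 4 - b t - 2 * c t * alpha t - 4 * a t * alpha t ^+ 2.
  by rewrite -ea; ring.
have eb' : beta^`()%classic t = - ((c t + 4 * a t * alpha t) * beta t).
  by apply/eqP; rewrite -subr_eq0 opprK eb.
have ed' : delta^`()%classic t = 2 * a t * beta t ^+ 3 * epsilon t
    - (c t + 4 * a t * alpha t) * delta t + f t + 2 * g t * alpha t.
  by rewrite -ed; ring.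
have ee' : epsilon^`()%classic t = (g t - 2 * a t * delta t) * beta t.
  by apply/eqP; rewrite -subr_eq0 ee.
apply: (heisenberg_affine d eA).
(* Written in the ring of functions, the coefficient gets its derivative by instance inference;
   likewise for the other two. *)
- have -> : mode_x u w = u * beta - w * ((2 *: alpha) * (fun s => (beta s)^-1)) by [].
  apply: is_derive_eq.
  rewrite ea' eb' !fctE /mode_x /mode_p /GRing.scale /=; field.
  exact: b0.
- have -> : mode_p w = w * (fun s => (beta s)^-1) by [].
  apply: is_derive_eq.
  rewrite eb' !fctE /mode_x /mode_p /GRing.scale /=; field.
  exact: b0.
- have -> : mode_1 u w = u * epsilon - w * (delta * (fun s => (beta s)^-1)) by [].
  apply: is_derive_eq.
  rewrite ed' ee' eb' !fctE /mode_x /mode_p /GRing.scale /=; field.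
  exact: b0.
Qed.

Lemma is_derive_phase (a b c f g kappa : R -> R) t :
  ermakov_system a b c f g alpha beta gamma delta epsilon kappa t ->
  is_derive t 1 (fun s => 2 * gamma s) (- (2 * a t * beta t ^+ 2)).
Proof.
move=> [[_ _ dc] [_ [[_ _ ec] _]]].
have {}dc := derivableP dc; rewrite -derive1E in dc.
have -> : (fun s => 2 * gamma s) = 2 *: gamma by [].
apply: is_derive_eq; rewrite /GRing.scale /=.
have /eqP := ec; rewrite addr_eq0 => /eqP ->; ring.
Qed.

End Ladder.
End Modes.

Theorem theorem1 (R : realType) (V : completeNormedModType R[i])
    (ip : {dot V for @Num.conj R[i]}) (hilbertV : hilbert_norm ip)
    (x p : op V) (x_sa : self_adjoint ip x) (p_sa : self_adjoint ip p)
    (D : set V) (xp_ccr : ccr D x p)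
    (J : set R) (openJ : open J) (itvJ : is_interval J)
    (a b c d f g : R -> R)
    (alpha beta gamma delta epsilon kappa : R -> R)
    (beta_neq0 : forall t, J t -> beta t != 0)
    (sol : forall t, J t ->
      ermakov_system a b c f g alpha beta gamma delta epsilon kappa t) :
  let H := hamiltonian x p a b c d f g in
  let bh := annihilation x p alpha beta gamma delta epsilon in
  let bhd := creation x p alpha beta gamma delta epsilon in
  let pl := p_mode x p alpha beta gamma delta epsilon in
  let ql := q_mode x p alpha beta gamma delta epsilon in
  forall t, J t ->
    [/\ heisenberg D pl H t,
        heisenberg D ql H t &
        (bh t * bhd t - bhd t * bh t = 1 on D)%op].
Proof.
move=> H bh bhd pl ql t Jt.
have b0 := beta_neq0 t Jt; have sys := sol t Jt.
(* Linearity comes from self-adjointness, invariance of [D] from [ccr]. *)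
have stable_sa A : self_adjoint ip A -> D `<=` op_dom A `&` (op_app A @^-1` D) ->
    stable_op D A.
  move=> [[_ A_lin] _ _] DA; split=> [v /DA[]//|v /DA[]//|k u v /DA[Au _] /DA[Av _]].
  exact: A_lin.
have [_ _ Dx Dp _] := xp_ccr.
have sx := stable_sa _ x_sa Dx; have sp := stable_sa _ p_sa Dp.
have dphase := is_derive_phase sys.
split; last exact: ladder_ccr.
(* Here [u = - sin (2 gamma)] and [w = cos (2 gamma)]; the chain rule with phase speed
   [- 2 a beta^2] gives the required [u'] and [w']. *)
- apply: (heisenberg_mode sx sp xp_ccr d b0 sys) (p_mode_affine sx sp xp_ccr _ _ _ _ _).
    have -> : (fun s => - sin (2 * gamma s)) = - (sin \o (fun s => 2 * gamma s)) by [].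
    by apply: is_derive_eq; rewrite /GRing.scale /=; ring.
  have -> : (fun s => cos (2 * gamma s)) = cos \o (fun s => 2 * gamma s) by [].
  by apply: is_derive_eq; rewrite /GRing.scale /=; ring.
- apply: (heisenberg_mode sx sp xp_ccr d b0 sys) (q_mode_affine sx sp xp_ccr _ _ _ _ _).
    have -> : (fun s => cos (2 * gamma s)) = cos \o (fun s => 2 * gamma s) by [].
    by apply: is_derive_eq; rewrite /GRing.scale /=; ring.
  have -> : (fun s => sin (2 * gamma s)) = sin \o (fun s => 2 * gamma s) by [].
  by apply: is_derive_eq; rewrite /GRing.scale /=; ring.
Qed.
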